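(* Let $w$ be an infinite recurrent binary word (over $\Sigma=\{0,1\}$, containing both letters) generated by a morphism $\phi$. Then $w$ satisfies the WELLDOC property if and only if $\det A_\phi = \pm 1$.
   Context: A morphism $\phi:\Sigma^*\to\Sigma^*$ is nonerasing; an infinite word $w$ is generated by $\phi$ if $\phi(a)=as$ for a letter $a$ and a nonempty word $s$, and $w=\lim_{n\to\infty}\phi^n(a)$ (limit in the prefix sense). The matrix $A_\phi$ is the $\sigma\times\sigma$ integer matrix ($\sigma=|\Sigma|$) whose entry in row $j$, column $i$ is $|\phi(i)|_j$, the number of occurrences of letter $j$ in $\phi(i)$. The Parikh vector of a finite word $u$ is $V_u=(|u|_0,\dots,|u|_{\sigma-1})$. For a factor $u$ of $w$ occurring at positions $a_0,a_1,\dots$, let $X_u=\{V_{w[0,a_i)}: i\ge 0\}$ (Parikh vectors of the prefixes preceding occurrences of $u$) and $X_{u,m}$ the set of these vectors reduced modulo $m$. The word $w$ satisfies WELLDOC if $X_{u,m}=(\mathbb{Z}/m\mathbb{Z})^\sigma$ for every integer $m\ge1$ and every factor $u$ of $w$. A word is recurrent if each of its factors occurs infinitely often. By convention, a binary word contains both letters $0$ and $1$. *)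

(* Defs.v *)
From mathcomp Require Import all_boot all_order all_algebra.

Set Implicit Arguments.
Unset Strict Implicit.
Unset Printing Implicit Defensive.

(* The alphabet {0, ..., s-1} is 'I_s, finite words are
   seq 'I_s, and infinite words are functions nat -> 'I_s. *)

Definition morphism_words (s : nat) (phi : seq 'I_s -> seq 'I_s) : Prop :=
  phi [::] = [::] /\ forall u v : seq 'I_s, phi (u ++ v) = phi u ++ phi v.

Definition nonerasing (s : nat) (phi : seq 'I_s -> seq 'I_s) : Prop :=
  forall a : 'I_s, phi [:: a] <> [::].

Definition word_limit (s : nat) (x : nat -> seq 'I_s) (w : nat -> 'I_s) : Prop :=
  forall k : nat, exists N : nat, forall n : nat,
    N <= n -> prefix (mkseq w k) (x n).

Definition generated_by (s : nat) (phi : seq 'I_s -> seq 'I_s)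
    (w : nat -> 'I_s) : Prop :=
  exists (a : 'I_s) (t : seq 'I_s),
    [/\ phi [:: a] = a :: t, t <> [::]
      & word_limit (fun n => iter n phi [:: a]) w].

Definition morphism_matrix (s : nat) (phi : seq 'I_s -> seq 'I_s) : 'M[int]_s :=
  \matrix_(j < s, i < s) Posz (count_mem j (phi [:: i])).

Definition parikh (s : nat) (u : seq 'I_s) : 'rV[nat]_s :=
  \row_(j < s) count_mem j u.

Definition occurs_at (s : nat) (w : nat -> 'I_s) (u : seq 'I_s) (i : nat) : Prop :=
  [seq w k | k <- iota i (size u)] = u.

Definition factor (s : nat) (w : nat -> 'I_s) (u : seq 'I_s) : Prop :=
  exists i : nat, occurs_at w u i.

Definition recurrent (s : nat) (w : nat -> 'I_s) : Prop :=
  forall u : seq 'I_s, factor w u ->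
  forall N : nat, exists2 i : nat, N <= i & occurs_at w u i.

Definition occ_parikh (s : nat) (w : nat -> 'I_s) (u : seq 'I_s)
    (V : 'rV[nat]_s) : Prop :=
  exists2 i : nat, occurs_at w u i & V = parikh (mkseq w i).

(* For m > 0, Z/mZ is represented by the canonical residues 'I_m; 'Z_m would
   be wrong for m = 1, where it has two elements. *)
Definition occ_parikh_mod (s : nat) (w : nat -> 'I_s) (u : seq 'I_s) (m : nat)
    (v : 'rV['I_m]_s) : Prop :=
  exists2 V : 'rV[nat]_s, occ_parikh w u V &
    forall j : 'I_s, V ord0 j %% m = v ord0 j.

Definition welldoc (s : nat) (w : nat -> 'I_s) : Prop :=
  forall (m : nat) (u : seq 'I_s), 0 < m -> factor w u ->
  forall v : 'rV['I_m]_s, occ_parikh_mod w u v.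

(* Main.v *)
(* Write [A] for the matrix of [phi], and let [V] be the Parikh vector of a prefix
   of [w] followed by an occurrence of the factor under consideration.

   If [det A = 1] or [det A = -1], then [A] has finite order modulo [m], so a power
   of [phi] carries the prefixes preceding the first letter [a] to prefixes preceding
   any given prefix of [w], without changing their vectors modulo [m].  Hence the set
   [S] of vectors [V] modulo [m] for the factor [a] is a group, stable under [A] and
   its inverse, and it suffices to find both basis vectors in [S].  They come from the
   factors [aa], [bb] or [aba]; the words where this fails are alternating or
   not recurrent.

   If a prime [p] divides [det A], choose a nonzero linear form modulo [p] that kills
   the columns of [A].  It vanishes on all blocks [phi k], so under WELLDOC a long
   factor can be cut into blocks in two ways without a common cutting point.  Once
   [phi] is conjugated so that the two blocks start with different letters, each way
   of cutting determines how the other one goes on, so [w] is eventually periodic,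
   which contradicts WELLDOC.  If no such conjugate exists, [w] is periodic already. *)

Require Import Defs.
From mathcomp Require Import all_boot all_order all_algebra all_fingroup.
From mathcomp Require Import zify ring.

Set Implicit Arguments.
Unset Strict Implicit.
Unset Printing Implicit Defensive.

Import GRing.Theory.

(** * Prefixes and occurrences in an infinite word *)

Definition is_prefix (s : nat) (w : nat -> 'I_s) (q : seq 'I_s) : Prop :=
  mkseq w (size q) = q.

Lemma is_prefix_mkseq s (w : nat -> 'I_s) k : is_prefix w (mkseq w k).
Proof. by rewrite /is_prefix size_mkseq. Qed.

Lemma take_mkseq_leq s (w : nat -> 'I_s) i j :
  i <= j -> take i (mkseq w j) = mkseq w i.
Proof. by move=> le_ij; rewrite /mkseq -map_take take_iota (minn_idPl le_ij). Qed.

Lemma is_prefix_prefix s (w : nat -> 'I_s) q r :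
  prefix q r -> is_prefix w r -> is_prefix w q.
Proof.
move=> /[dup] /size_prefix le_qr; rewrite prefixE /is_prefix => /eqP def_q def_r.
by rewrite -{2}def_q -def_r take_mkseq_leq.
Qed.

Lemma is_prefix_catl s (w : nat -> 'I_s) q r : is_prefix w (q ++ r) -> is_prefix w q.
Proof. exact/is_prefix_prefix/prefix_prefix. Qed.

Lemma is_prefix_total s (w : nat -> 'I_s) q r :
  is_prefix w q -> is_prefix w r -> size q <= size r -> prefix q r.
Proof.
rewrite /is_prefix => def_q def_r le_qr.
by rewrite prefixE -def_r take_mkseq_leq ?def_q.
Qed.

Lemma is_prefix_nth s (w : nat -> 'I_s) q c i :
  is_prefix w q -> i < size q -> nth c q i = w i.
Proof. by move=> def_q lt_i; rewrite -def_q nth_mkseq. Qed.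

Lemma occurs_at_prefix s (w : nat -> 'I_s) u i :
  occurs_at w u i <-> is_prefix w (mkseq w i ++ u).
Proof.
rewrite /occurs_at /is_prefix size_cat size_mkseq {1}/mkseq iotaD map_cat add0n.
split=> [-> // | /eqP]; rewrite eqseq_cat ?size_map ?size_iota //.
by case/andP=> _ /eqP.
Qed.

Lemma prefix_occurs_at s (w : nat -> 'I_s) q u :
  is_prefix w (q ++ u) -> occurs_at w u (size q) /\ mkseq w (size q) = q.
Proof.
move=> pref_qu; have def_q := is_prefix_catl pref_qu.
by split=> //; apply/occurs_at_prefix; rewrite def_q.
Qed.

(* [welldoc] over natural number vectors, free of the types 'I_m. *)
Lemma welldocP s (w : nat -> 'I_s) :
  welldoc w <-> forall m u (V : 'I_s -> nat), 0 < m -> factor w u ->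
    exists2 q, is_prefix w (q ++ u) & forall j, count_mem j q = V j %[mod m].
Proof.
split=> [wd m u V m_gt0 fu | wd m u m_gt0 fu v].
  have [V' [i occ_i ->] eqV] := wd m u m_gt0 fu
    (\row_j Ordinal (ltn_pmod (V j) m_gt0))%R.
  exists (mkseq w i); first exact: (occurs_at_prefix _ _ _).1.
  by move=> j; have := eqV j; rewrite !mxE.
have [q pref_q eqV] := wd m u (fun j => nat_of_ord (v ord0 j)) m_gt0 fu.
have [occ_q def_q] := prefix_occurs_at pref_q.
exists (parikh q); first by exists (size q); rewrite ?def_q.
by move=> j; rewrite mxE eqV modn_small.
Qed.

Lemma mkseqSr s (w : nat -> 'I_s) i : mkseq w i.+1 = mkseq w i ++ [:: w i].
Proof. by rewrite /mkseq -addn1 iotaD map_cat. Qed.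

(* The Parikh vectors modulo [m] of the prefixes of an eventually periodic word
   take [O(m)] values, too few for the [m ^ s] required with [u] empty. *)
Lemma eventually_periodic_not_welldoc s (w : nat -> 'I_s) N q :
  1 < s -> 0 < q -> (forall i, N <= i -> w (i + q) = w i) -> ~ welldoc w.
Proof.
move=> s_gt1 q_gt0 w_per /welldocP wd.
pose V i j := count_mem j (mkseq w i).
have VS i j : V i.+1 j = V i j + (w i == j) by rewrite /V mkseqSr count_cat /= addn0.
have Vq i j : N <= i -> V (i + q) j + V N j = V i j + V (N + q) j.
  move=> le_Ni; rewrite -(subnKC le_Ni).
  elim: (i - N) => [|k IHk]; first by rewrite addn0 addnC.
  by rewrite addnS addSn !VS addnAC IHk addnAC addnAC w_per ?leq_addr // addnAC.
have le_V j k : V N j <= V (N + k) j.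
  by elim: k => [|k IHk]; rewrite ?addn0 // addnS VS (leq_trans IHk) ?leq_addr.
have Vkq i j k : N <= i -> V (i + k * q) j = V i j + k * (V (N + q) j - V N j).
  move=> le_Ni; elim: k => [|k IHk]; first by rewrite !addn0.
  have := Vq (i + k * q) j (leq_trans le_Ni (leq_addr _ _)).
  by have := le_V j q; rewrite (_ : i + k.+1 * q = i + k * q + q) //; lia.
(* This choice makes [K < m ^ 2]. A shift by [m] periods changes every count by a multiple of [m],
   so the indices below [K] realise all classes. *)
pose m := (N + q).+1; pose K := N + m * q.
have small i : exists2 i', i' < K & forall j, V i' j = V i j %[mod m].
  have [lt_iN | le_Ni] := ltnP i N; first by exists i; rewrite // ltn_addr.
  exists (N + (i - N) %% (m * q)) => [|j]; first by rewrite ltn_add2l ltn_pmod // muln_gt0.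
  rewrite -{2}(subnKC le_Ni) {2}(divn_eq (i - N) (m * q)) mulnA addnA addnAC.
  by rewrite Vkq ?leq_addr // [in RHS]mulnAC [in RHS]addnC modnMDl.
pose F (i : 'I_K) : {ffun 'I_s -> 'I_m} := [ffun j => inord (V i j %% m)].
have: #|{ffun 'I_s -> 'I_m}| <= #|codom F|.
  apply/subset_leq_card/subsetP=> f _; apply/codomP.
  have f0 : factor w [::] by exists 0.
  have [p /is_prefix_catl pref_p eqf] := wd m [::] (fun j => val (f j)) (ltn0Sn _) f0.
  have [i' lt_i' eqV] := small (size p).
  exists (Ordinal lt_i'); apply/ffunP=> j; apply/val_inj.
  by rewrite ffunE /= inordK ?ltn_pmod // eqV /V pref_p eqf modn_small ?ltn_ord.
move/leq_trans/(_ (leq_image_card _ _)); rewrite card_ffun !card_ord.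
apply/negP; rewrite -ltnNge; apply: (@leq_trans (m ^ 2)); last by rewrite leq_pexp2l.
by rewrite /K /m; nia.
Qed.

(** * Parikh vectors over a ring and the matrix of the morphism *)

Definition pvec (R : comNzRingType) (s : nat) (u : seq 'I_s) : 'rV[R]_s :=
  (\row_j (count_mem j u)%:R)%R.

(** Transposed because Parikh vectors are rows here, so that [phi] acts by multiplication on the
    right. *)
Definition incidence (R : comNzRingType) (s : nat) (phi : seq 'I_s -> seq 'I_s) : 'M[R]_s :=
  (map_mx intr (morphism_matrix phi))^T%R.

Lemma pvec_nil (R : comNzRingType) s : pvec R [::] = 0%R :> 'rV_s.
Proof. by apply/rowP=> j; rewrite !mxE. Qed.

Lemma pvec_cat (R : comNzRingType) s (u v : seq 'I_s) :
  pvec R (u ++ v) = (pvec R u + pvec R v)%R.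
Proof. by apply/rowP=> j; rewrite !mxE count_cat natrD. Qed.

Lemma pvec1 (R : comNzRingType) s (c : 'I_s) : pvec R [:: c] = delta_mx 0%R c.
Proof. by apply/rowP=> j; rewrite !mxE /= addn0 eq_sym. Qed.

Lemma pvec_morphism (R : comNzRingType) s (phi : seq 'I_s -> seq 'I_s) u :
  morphism_words phi -> pvec R (phi u) = (pvec R u *m incidence R phi)%R.
Proof.
case=> phi0 phiM; elim: u => [|c u IHu]; first by rewrite phi0 pvec_nil mul0mx.
rewrite -cat1s phiM !pvec_cat IHu mulmxDl; congr (_ + _)%R.
by rewrite pvec1 -rowE; apply/rowP=> j; rewrite !mxE.
Qed.

Lemma det_incidence (R : comNzRingType) s (phi : seq 'I_s -> seq 'I_s) :
  (\det (incidence R phi) = (\det (morphism_matrix phi))%:~R)%R.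
Proof. by rewrite det_tr det_map_mx. Qed.

(** * Iterates of the morphism *)

Lemma pvec_iter (R : comNzRingType) s (phi : seq 'I_s.+1 -> seq 'I_s.+1) n u :
  morphism_words phi ->
  pvec R (iter n phi u) = (pvec R u *m incidence R phi ^+ n)%R.
Proof.
move=> phiP; elim: n => [|n IHn]; first by rewrite expr0 mulmx1.
by rewrite iterS pvec_morphism // IHn exprSr mulmxA.
Qed.

Lemma iter_morphism s (phi : seq 'I_s -> seq 'I_s) n :
  morphism_words phi -> morphism_words (iter n phi).
Proof.
case=> phi0 phiM; elim: n => [|n [IH0 IHM]] //=.
by split=> [|u v] /=; rewrite ?IH0 // IHM phiM.
Qed.

(** As [phi [:: a]] starts with [a], each iterate is a prefix of all later ones, and late iterates
    agree with [w] on any given length. *)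
Lemma generated_iter_prefix s (phi : seq 'I_s -> seq 'I_s) w a t n :
    morphism_words phi -> phi [:: a] = a :: t ->
    word_limit (fun n => iter n phi [:: a]) w ->
  is_prefix w (iter n phi [:: a]).
Proof.
move=> phiP phi_a lim_w.
have iter_prefix k : prefix (iter n phi [:: a]) (iter (k + n) phi [:: a]).
  elim: k => [|k IHk]; first exact: prefix_refl.
  apply: prefix_trans IHk _; rewrite addSn iterSr phi_a -(cat1s a t).
  by rewrite (iter_morphism (k + n) phiP).2 prefix_prefix.
have [N /(_ (N + n) (leq_addr _ _)) pref_w] := lim_w (size (iter n phi [:: a])).
rewrite /is_prefix; move: pref_w (iter_prefix N); rewrite !prefixE size_mkseq.
by move=> /eqP <- /eqP.
Qed.

Lemma generated_prefix_morphism s (phi : seq 'I_s -> seq 'I_s) w a t q :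
    morphism_words phi -> phi [:: a] = a :: t ->
    word_limit (fun n => iter n phi [:: a]) w ->
  is_prefix w q -> is_prefix w (phi q).
Proof.
move=> phiP phi_a lim_w pref_q.
have [N /(_ N (leqnn N))] := lim_w (size q); rewrite pref_q => /prefixP[r def_r].
apply: is_prefix_prefix (generated_iter_prefix N.+1 phiP phi_a lim_w).
by rewrite iterS def_r phiP.2 prefix_prefix.
Qed.

(** * Two parses of a word into marked blocks *)

Definition marked (s : nat) (f : 'I_s -> seq 'I_s) : Prop :=
  (forall k, f k <> [::]) /\
  forall x k k' v v', f k = x :: v -> f k' = x :: v' -> k = k'.

Definition image_word (s : nat) (f : 'I_s -> seq 'I_s) (y : seq 'I_s) : seq 'I_s :=
  flatten (map f y).

(* The part of the current block that is still to be read, after reading the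
   letter [x]; an empty [r] means that a new block begins. *)
Definition residual_step (s : nat) (f : 'I_s -> seq 'I_s) (r : seq 'I_s) (x : 'I_s) :=
  behead (if r is [::] then
            if [pick k | ohead (f k) == Some x] is Some k then f k else [::]
          else r).

(** The default [c] is reached only when both residuals are empty, which different weights
    exclude. *)
Definition forced_letter (s : nat) (c : 'I_s) (r : seq 'I_s * seq 'I_s) : 'I_s :=
  head (head c r.2) r.1.

Definition residual_pair_step (s : nat) (f : 'I_s -> seq 'I_s) (c : 'I_s)
    (r : seq 'I_s * seq 'I_s) :=
  (residual_step f r.1 (forced_letter c r), residual_step f r.2 (forced_letter c r)).

(** Two of the first [size l + 1] iterates coincide, which gives a period at most [size l]. The
    factorial is a multiple of it that does not depend on the orbit. *)
Lemma iter_eventually_periodic (T : eqType) (g : T -> T) x (l : seq T) :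
    (forall n, iter n g x \in l) ->
  forall i, size l <= i -> iter (i + (size l)`!) g x = iter i g x.
Proof.
move=> g_l; set t := mkseq (fun n => iter n g x) (size l).+1.
have : ~~ uniq t.
  apply/negP=> uniq_t; suff /(uniq_leq_size uniq_t) : {subset t <= l}.
    by rewrite size_mkseq ltnn.
  by move=> _ /mapP[n _ ->].
case/(uniqPn x)=> i [j] []; rewrite size_mkseq => lt_ij lt_j.
rewrite !nth_mkseq // ?(ltn_trans lt_ij) // => eq_ij.
have per n k : i <= n -> iter (n + k * (j - i)) g x = iter n g x.
  move=> le_in; elim: k => [|k IHk]; first by rewrite addn0.
  rewrite mulSn addnA addnAC -{1}(subnKC le_in) -IHk.
  rewrite -[n in RHS](subnKC le_in).
  rewrite (_ : i + (n - i) + k * (j - i) + (j - i) = n - i + k * (j - i) + j); last lia.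
  rewrite (_ : i + (n - i) + k * (j - i) = n - i + k * (j - i) + i); last lia.
  by rewrite !iterD -eq_ij.
move=> n le_n; have /dvdnP[k ->] : j - i %| (size l)`!.
  by apply: dvdn_fact; apply/andP; split; lia.
by apply: per; lia.
Qed.

(** Whole blocks weigh nothing, so reading a letter lowers both residual weights by the weight of
    that letter and keeps their difference. Hence the residuals are never both empty, and a nonempty
    one shows the next letter. *)
Lemma parses_determine s (f : 'I_s -> seq 'I_s) c (V : zmodType) (wt : seq 'I_s -> V) :
    marked f -> (forall u v, wt (u ++ v) = (wt u + wt v)%R) ->
    (forall k, wt (f k) = 0%R) ->
  forall u r1 r2 y1 y2, prefix u (r1 ++ image_word f y1) ->
    prefix u (r2 ++ image_word f y2) -> wt r1 <> wt r2 ->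
  forall i, i < size u ->
    nth c u i = forced_letter c (iter i (residual_pair_step f c) (r1, r2)).
Proof.
move=> [f_neq0 f_inj] wtD wt_f; elim=> // x u IHu r1 r2 y1 y2 pref1 pref2 neq_r.
have wt0 : wt [::] = 0%R by apply: (addrI (wt [::])); rewrite -wtD addr0.
have step r y : prefix (x :: u) (r ++ image_word f y) ->
    (exists y', prefix u (residual_step f r x ++ image_word f y')) /\
    (wt (residual_step f r x) = wt r - wt [:: x])%R.
  case: r => [|x' r] /=; last first.
    case/andP=> /eqP<- pref_u; split; first by exists y.
    by rewrite /residual_step /= -cat1s wtD addrC addKr.
  case: y => [|k y] //=; rewrite /image_word /=.
  case def_k: (f k) => [|x' v]; first by case: (f_neq0 k).
  case/andP=> /eqP eq_x; rewrite -{}eq_x in def_k * => pref_u.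
  have -> : residual_step f [::] x = v.
    rewrite /residual_step; case: pickP => [k' | /(_ k)]; last by rewrite def_k eqxx.
    case def_k': (f k') => [|y' v'] //= /eqP[eq_x]; rewrite {}eq_x in def_k'.
    by move: (def_k'); rewrite -(f_inj _ _ _ _ _ def_k def_k') def_k => -[->].
  split; first by exists y.
  by rewrite wt0 -(wt_f k) def_k -(cat1s x) wtD addrC addKr.
have [[y1' pref1'] wt1'] := step _ _ pref1.
have [[y2' pref2'] wt2'] := step _ _ pref2.
have letter : forced_letter c (r1, r2) = x.
  case: r1 r2 {step pref1' wt1' pref2' wt2'} pref1 pref2 neq_r => [|x1 r1] [|x2 r2] //=.
  - by move=> _ /andP[/eqP->].
  - by move=> /andP[/eqP->].
  - by move=> /andP[/eqP->].
case=> [_ | i lt_i]; first by rewrite /= letter.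
rewrite iterSr {2}/residual_pair_step letter /=.
apply: (IHu _ _ _ _ pref1' pref2') lt_i.
by rewrite wt1' wt2' => /addIr.
Qed.

Definition residual (s : nat) (f : 'I_s -> seq 'I_s) (r : seq 'I_s) : Prop :=
  r = [::] \/ exists k n, r = drop n (f k).

Lemma residual_stepP s (f : 'I_s -> seq 'I_s) r x :
  residual f r -> residual f (residual_step f r x).
Proof.
have behead_drop n k : residual f (behead (drop n (f k))).
  by right; exists k, n.+1; rewrite -drop1 drop_drop.
rewrite /residual_step; case: r => [_ | y r].
  by case: pickP => [k _ | _]; [rewrite -[f k]drop0 | left].
by case=> // -[k [n ->]].
Qed.

Lemma residual_finite s (f : 'I_s -> seq 'I_s) :
  exists l : seq (seq 'I_s), forall r, residual f r -> r \in l.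
Proof.
exists ([::] :: [seq drop n (f k) | k <- enum 'I_s, n <- iota 0 (\max_k size (f k))]).
move=> _ [-> | [k [n ->]]]; first exact: mem_head.
have [le_n | lt_n] := leqP (size (f k)) n; first by rewrite drop_oversize ?mem_head.
rewrite inE; apply/orP; right; apply: allpairs_f_dep; first by rewrite mem_enum.
by rewrite mem_iota /= add0n (leq_trans lt_n) ?(leq_bigmax k).
Qed.

(** The states are pairs of suffixes of blocks, hence finitely many. [M] and [Q] come from [f]
    alone, so one period serves words [u] of every length. *)
Lemma parses_periodic s (f : 'I_s -> seq 'I_s) (c : 'I_s) :
    marked f ->
  exists M, exists2 Q, 0 < Q &
  forall (V : zmodType) (wt : seq 'I_s -> V) u r1 r2 y1 y2,
    (forall u v, wt (u ++ v) = (wt u + wt v)%R) -> (forall k, wt (f k) = 0%R) ->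
    residual f r1 -> residual f r2 -> wt r1 <> wt r2 ->
    prefix u (r1 ++ image_word f y1) -> prefix u (r2 ++ image_word f y2) ->
  forall i, M <= i -> i + Q < size u -> nth c u (i + Q) = nth c u i.
Proof.
move=> f_marked; have [l lP] := residual_finite f.
pose l2 := [seq (r1, r2) | r1 <- l, r2 <- l].
exists (size l2), (size l2)`!; first exact: fact_gt0.
move=> V wt u r1 r2 y1 y2 wtD wt_f res1 res2 neq_r pref1 pref2 i le_i lt_i.
have det := parses_determine c f_marked wtD wt_f pref1 pref2 neq_r.
rewrite !det //; last by rewrite (leq_ltn_trans _ lt_i) ?leq_addr.
rewrite iter_eventually_periodic // => n.
suff [res_n1 res_n2] : residual f (iter n (residual_pair_step f c) (r1, r2)).1 /\
                       residual f (iter n (residual_pair_step f c) (r1, r2)).2.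
  by rewrite [iter _ _ _]surjective_pairing; apply: allpairs_f; apply: lP.
by elim: n => [|n [IH1 IH2]] //=; split; apply: residual_stepP.
Qed.

(** Let [r] be the rest of the block in which [q] ends. Then [q ++ r] is a product of blocks and
    weighs nothing. *)
Lemma parse_from s (f : 'I_s -> seq 'I_s) (V : zmodType) (wt : seq 'I_s -> V) :
    (forall u v, wt (u ++ v) = (wt u + wt v)%R) -> (forall k, wt (f k) = 0%R) ->
  forall y q u, prefix (q ++ u) (image_word f y) ->
  exists r y', [/\ residual f r, prefix u (r ++ image_word f y')
                 & (wt q + wt r = 0)%R].
Proof.
move=> wtD wt_f; have wt0 : wt [::] = 0%R.
  by apply: (addrI (wt [::])); rewrite -wtD addr0.
have empty_q y u : prefix u (image_word f y) -> exists r y',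
    [/\ residual f r, prefix u (r ++ image_word f y') & (wt [::] + wt r = 0)%R].
  by move=> pref_u; exists [::], y; split; [left | | rewrite wt0 addr0].
elim=> [|k y IHy] q u; rewrite /image_word /=.
  by case: q u => [|//] [|//] _; apply: (empty_q [::]).
have [le_q | /ltnW le_f] := leqP (size q) (size (f k)).
  rewrite -{1}(cat_take_drop (size q) (f k)) -catA prefix_catr ?size_takel //.
  case/andP=> /eqP def_q pref_u; exists (drop (size q) (f k)), y; split=> //.
    by right; exists k, (size q).
  by rewrite {1}def_q -wtD cat_take_drop.
rewrite -{1}(cat_take_drop (size (f k)) q) -catA prefix_catr ?size_takel //.
case/andP=> /eqP def_f /IHy[r [y' [res_r pref_u wt_r]]]; exists r, y'; split=> //.
by rewrite -(cat_take_drop (size (f k)) q) wtD def_f wt_f add0r.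
Qed.

(** * Conjugates [z^-1 phi z] of the morphism *)

Definition conjugate_by (s : nat) (phi : seq 'I_s -> seq 'I_s) (z : seq 'I_s)
    (f : 'I_s -> seq 'I_s) : Prop :=
  forall k, phi [:: k] ++ z = z ++ f k.

Lemma conjugate_image s (phi : seq 'I_s -> seq 'I_s) z f y :
  morphism_words phi -> conjugate_by phi z f -> phi y ++ z = z ++ image_word f y.
Proof.
case=> phi0 phiM conj_f; rewrite /image_word.
elim: y => [|k y IHy] /=; first by rewrite phi0 cats0.
by rewrite -cat1s phiM -catA IHy !catA conj_f.
Qed.

Lemma size_nonerasing s (phi : seq 'I_s -> seq 'I_s) u :
  morphism_words phi -> nonerasing phi -> size u <= size (phi u).
Proof.
case=> phi0 phiM phi_ne; elim: u => // c u IHu.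
rewrite -cat1s phiM !size_cat leq_add //.
by case: (phi [:: c]) (phi_ne c).
Qed.

Lemma conjugator_prefix s (phi : seq 'I_s -> seq 'I_s) w z f :
    morphism_words phi -> nonerasing phi ->
    (forall q, is_prefix w q -> is_prefix w (phi q)) -> conjugate_by phi z f ->
  is_prefix w z.
Proof.
move=> phiP phi_ne phi_w conj_f; pose y := mkseq w (size z).
apply: is_prefix_prefix (phi_w _ (is_prefix_mkseq w (size z))).
have : prefix z (phi y ++ z) by rewrite (conjugate_image y phiP conj_f) prefix_prefix.
have := size_nonerasing y phiP phi_ne; rewrite size_mkseq => le_z.
by rewrite !prefixE takel_cat.
Qed.

(** Cancelling [z] in [phi y ++ z = z ++ image_word f y], for a long prefix [y] of [w], cuts what
    follows [z] in [w] into blocks [f k]. *)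
Lemma prefix_conjugate_image s (phi : seq 'I_s -> seq 'I_s) w z f q :
    morphism_words phi -> nonerasing phi ->
    (forall q, is_prefix w q -> is_prefix w (phi q)) -> conjugate_by phi z f ->
  is_prefix w (z ++ q) -> exists y, prefix q (image_word f y).
Proof.
move=> phiP phi_ne phi_w conj_f pref_q; pose y := mkseq w (size (z ++ q)); exists y.
have le_q := size_nonerasing y phiP phi_ne; rewrite size_mkseq in le_q.
have := is_prefix_total pref_q (phi_w _ (is_prefix_mkseq w _)) le_q.
move/(prefix_catl z); rewrite (conjugate_image y phiP conj_f).
by rewrite prefix_catr // eqxx.
Qed.

(* Two occurrences of a long factor of [w] whose preceding prefixes have
   different weights are cut into blocks [f k] in two ways that never share a
   cutting point.  Each parse then forces the next block of the other. *)
Lemma marked_periodic s (phi : seq 'I_s -> seq 'I_s) w z f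
    (V : zmodType) (wt : seq 'I_s -> V) :
    morphism_words phi -> nonerasing phi ->
    (forall q, is_prefix w q -> is_prefix w (phi q)) ->
    conjugate_by phi z f -> marked f ->
    (forall u v, wt (u ++ v) = (wt u + wt v)%R) ->
    (forall k, wt (phi [:: k]) = 0%R) ->
    (forall u, factor w u -> exists2 q, is_prefix w (q ++ u) & wt q <> 0%R) ->
  exists N, exists2 Q, 0 < Q & forall i, N <= i -> w (i + Q) = w i.
Proof.
move=> phiP phi_ne phi_w conj_f f_marked wtD wt_phi wd.
have wt_f k : wt (f k) = 0%R.
  by apply: (addrI (wt z)); rewrite -wtD -conj_f wtD wt_phi add0r addr0.
have wt0 : wt [::] = 0%R by apply: (addrI (wt [::])); rewrite -wtD addr0.
have pref_z := conjugator_prefix phiP phi_ne phi_w conj_f.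
have [M [Q Q_gt0 per]] := parses_periodic (w 0) f_marked.
exists (size z + M), Q => // i le_i.
have [u def_p] : exists u, mkseq w (i + Q).+1 = z ++ u.
  by apply/prefixP/(is_prefix_total pref_z (is_prefix_mkseq w _)); rewrite size_mkseq; lia.
have size_u : size u = (i + Q).+1 - size z.
  by rewrite -(size_mkseq w (i + Q).+1) def_p size_cat addKn.
have nth_u j : size z <= j <= i + Q -> nth (w 0) u (j - size z) = w j.
  case/andP=> le_zj le_j; have := nth_cat (w 0) z u j.
  by rewrite -def_p nth_mkseq // ltnNge le_zj.
have pref_zu : is_prefix w (z ++ u) by rewrite -def_p; apply: is_prefix_mkseq.
have [y1 pref1] := prefix_conjugate_image phiP phi_ne phi_w conj_f pref_zu.
have [q pref_q wt_q] : exists2 q, is_prefix w (q ++ (z ++ u)) & wt q <> 0%R.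
  by apply: wd; exists 0; apply/occurs_at_prefix.
rewrite catA in pref_q.
(* Both [z] and [q ++ z] are prefixes of [w], so [q ++ z = z ++ q'] with [q'] of the same weight as
   [q]. Removing [z] from [q ++ z ++ u] leaves [q' ++ u], which yields the second parse of [u]. *)
have /prefixP[q' def_q'] : prefix z (q ++ z).
  by apply: is_prefix_total pref_z (is_prefix_catl pref_q) _; rewrite size_cat leq_addl.
have wt_q' : wt q' = wt q by apply: (addrI (wt z)); rewrite -wtD -def_q' wtD addrC.
rewrite def_q' -catA in pref_q.
have [y2 pref_q'] := prefix_conjugate_image phiP phi_ne phi_w conj_f pref_q.
have [r [y2' [res_r pref2 wt_r]]] := parse_from wtD wt_f pref_q'.
have neq_r : wt [::] <> wt r.
  by rewrite wt0 => wt_r0; apply: wt_q; rewrite -wt_q' -wt_r -wt_r0 addr0.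
have := per _ _ _ _ _ _ _ wtD wt_f (or_introl erefl) res_r neq_r pref1 pref2 (i - size z).
rewrite (_ : i - size z + Q = i + Q - size z); last lia.
rewrite !nth_u; [apply; rewrite ?size_u | |]; lia.
Qed.

Lemma conjugate_rotate s (phi : seq 'I_s -> seq 'I_s) z f x :
    conjugate_by phi z f -> (forall k, ohead (f k) = Some x) ->
  conjugate_by phi (rcons z x) (fun k => rcons (behead (f k)) x).
Proof.
move=> conj_f head_f k; rewrite -!cats1 catA conj_f -!catA.
by case: (f k) (head_f k) => [|x' v] //= [->].
Qed.

Lemma conjugate_nil s (phi : seq 'I_s -> seq 'I_s) z f k :
  nonerasing phi -> conjugate_by phi z f -> f k <> [::].
Proof.
move=> phi_ne conj_f f0; apply: (phi_ne k); apply: size0nil.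
by have /(congr1 size) := conj_f k; rewrite f0 !size_cat addn0; lia.
Qed.

(** With two letters there is only one pair of blocks to compare. *)
Lemma not_marked_ohead (f : 'I_2 -> seq 'I_2) :
  (forall k, f k <> [::]) -> ~ marked f -> exists x, forall k, ohead (f k) = Some x.
Proof.
move=> f_ne not_marked.
have eq_head : ohead (f ord0) = ohead (f ord_max).
  apply/eqP/negbNE/negP=> neq_head; apply: not_marked; split=> // x k k' v v' def_k def_k'.
  apply/eqP/negbNE/negP=> neq_k; move: neq_head; apply/negP/negPn/eqP.
  have cases (c : 'I_2) : c = ord0 \/ c = ord_max.
    by case: c => [[|[|//]] lt_c]; [left | right]; apply/val_inj.
  by move: neq_k def_k def_k'; case: (cases k) (cases k') => -> [] -> //= _ -> ->.
case def0: (f ord0) (f_ne ord0) eq_head => [|x v] // _ /= eq_head; exists x => c.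
by case: c => [[|[|//]] lt_c]; [rewrite -[RHS]/(ohead (x :: v)) -def0 | rewrite eq_head];
  congr (ohead (f _)); apply/val_inj.
Qed.

(* A word [z] with [phi [:: k] ++ z = z ++ f k] has period [size (phi [:: k])],
   and it is a prefix of [w]. *)
Lemma never_marked_periodic (phi : seq 'I_2 -> seq 'I_2) w :
    morphism_words phi -> nonerasing phi ->
    (forall q, is_prefix w q -> is_prefix w (phi q)) ->
    (forall z f, conjugate_by phi z f -> ~ marked f) ->
  exists2 Q, 0 < Q & forall i, w (i + Q) = w i.
Proof.
move=> phiP phi_ne phi_w not_marked; exists (size (phi [:: ord0])).
  by case: (phi _) (phi_ne ord0).
move=> i; set Q := size _.
have [z [f [size_z conj_f]]] : exists z f, size z = (i + Q).+1 /\ conjugate_by phi z f.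
  elim: (i + Q).+1 => [|n [z [f [size_z conj_f]]]].
    by exists [::], (fun k => phi [:: k]); split=> // k; rewrite cats0.
  have f_ne k : f k <> [::] by apply: conjugate_nil conj_f.
  have [x head_f] := not_marked_ohead f_ne (not_marked z f conj_f).
  exists (rcons z x), (fun k => rcons (behead (f k)) x).
  by rewrite size_rcons size_z; split=> //; apply: conjugate_rotate.
have pref_z := conjugator_prefix phiP phi_ne phi_w conj_f.
have /(congr1 (fun v => nth (w 0) v (i + Q))) := conj_f ord0.
rewrite !nth_cat size_z ltnSn ltnNge leq_addl /= addnK.
by rewrite !(is_prefix_nth _ pref_z) ?size_z //; lia.
Qed.

(** * From WELLDOC to the determinant *)

Lemma eqmod_natr_Fp p m n : prime p -> m = n %[mod p] -> (m%:R = n%:R :> 'F_p)%R.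
Proof. by move=> p_pr eq_mn; rewrite -(Fp_nat_mod p_pr m) eq_mn Fp_nat_mod. Qed.

Lemma prime_annihilates_det (d : int) :
  ~ (d = 1%R \/ d = (-1)%R) -> exists2 p, prime p & (d%:~R = 0 :> 'F_p)%R.
Proof.
move=> d_neq; have [-> | d_neq0] := eqVneq d 0%R; first by exists 2.
have p_pr : prime (pdiv `|d|%N) by apply: pdiv_prime; lia.
exists (pdiv `|d|%N) => //.
have abs_d0 : (`|d|%N%:R = 0 :> 'F_(pdiv `|d|%N))%R.
  by rewrite -(Fp_nat_mod p_pr) (eqP (pdiv_dvd _)).
by rewrite [X in (X%:~R)%R]intEsign rmorphM /= rmorph_sign -pmulrn abs_d0 mulr0.
Qed.

Lemma welldoc_det (phi : seq 'I_2 -> seq 'I_2) w :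
    morphism_words phi -> nonerasing phi ->
    (forall q, is_prefix w q -> is_prefix w (phi q)) -> welldoc w ->
  (\det (morphism_matrix phi) = 1 \/ \det (morphism_matrix phi) = -1)%R.
Proof.
move=> phiP phi_ne phi_w wd; set d := (\det _)%R.
suff: ~ ~ (d = 1%R \/ d = (-1)%R).
  have [-> | /eqP d_neq1] := eqVneq d 1%R; first by left.
  by have [-> | /eqP d_neqN1] := eqVneq d (-1)%R; [right | case; case].
move/prime_annihilates_det=> [p p_pr d0].
(* [v] is the linear form modulo [p] that kills the columns of the matrix; its value on the Parikh
   vector of a word is the weight. *)
have /eqP/det0P[v v_neq0 vA0] : (\det (incidence 'F_p phi)^T = 0)%R.
  by rewrite det_tr det_incidence.
have [j v_j] : exists j, v ord0 j != 0%R by apply/rV0Pn.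
pose wt u : 'M['F_p]_1 := (pvec _ u *m v^T)%R.
have wtD u1 u2 : wt (u1 ++ u2) = (wt u1 + wt u2)%R by rewrite /wt pvec_cat mulmxDl.
have wt_phi k : wt (phi [:: k]) = 0%R.
  by rewrite /wt pvec_morphism // -mulmxA -[incidence _ _]trmxK -trmx_mul vA0 trmx0 mulmx0.
(* WELLDOC is applied to the unit vector at a coordinate [j] where [v] does not vanish. *)
have wd_wt u : factor w u -> exists2 q, is_prefix w (q ++ u) & wt q <> 0%R.
  move=> fu; have [q pref_q eqV] := (welldocP w).1 wd p u (fun j' => j' == j) (prime_gt0 p_pr) fu.
  have pvec_q : (pvec _ q = delta_mx 0 j :> 'rV['F_p]_2)%R.
    by apply/rowP=> j'; rewrite !mxE; apply: eqmod_natr_Fp.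
  exists q => //; rewrite /wt pvec_q -rowE => /rowP/(_ 0%R)/eqP; rewrite !mxE.
  exact/negP.
have no_period N Q : 0 < Q -> ~ forall i, N <= i -> w (i + Q) = w i.
  by move=> Q_gt0 per; apply: eventually_periodic_not_welldoc per wd.
have not_marked z f : conjugate_by phi z f -> ~ marked f.
  move=> conj_f f_marked.
  have [N [Q Q_gt0]] := marked_periodic phiP phi_ne phi_w conj_f f_marked wtD wt_phi wd_wt.
  exact: no_period.
have [Q Q_gt0 per] := never_marked_periodic phiP phi_ne phi_w not_marked.
exact: (no_period 0 Q).
Qed.

(** * Vectors of the prefixes that precede the first letter *)

Lemma unit_expr_eq1 (R : finUnitRingType) (x : R) :
  x \is a GRing.unit -> exists2 n, 0 < n & (x ^+ n = 1)%R.
Proof.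
move=> x_unit; exists #[FinRing.unit R x_unit]%g; first exact: order_gt0.
by rewrite -(FinRing.val_unitX _ (FinRing.unit R x_unit)) expg_order.
Qed.

Definition occ_class (R : comNzRingType) (s : nat) (w : nat -> 'I_s) (a : 'I_s)
    (v : 'rV[R]_s) : Prop :=
  exists2 q, is_prefix w (q ++ [:: a]) & pvec R q = v.

Lemma iter_prefix_morphism s (phi : seq 'I_s -> seq 'I_s) w q n :
  (forall q, is_prefix w q -> is_prefix w (phi q)) ->
  is_prefix w q -> is_prefix w (iter n phi q).
Proof. by move=> phi_w pref_q; elim: n => //= n; apply: phi_w. Qed.

(** Under [phi] iterated [n0 * N] times, [a] grows into a word starting with [u], while the vector
    of [q] is multiplied by a power of the identity. *)
Lemma occ_class_transport (R : comNzRingType) s (phi : seq 'I_s.+1 -> seq 'I_s.+1) w a N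
    (v : 'rV[R]_s.+1) u :
    morphism_words phi -> (forall q, is_prefix w q -> is_prefix w (phi q)) ->
    word_limit (fun n => iter n phi [:: a]) w ->
    0 < N -> (incidence R phi ^+ N = 1)%R ->
  occ_class w a v -> is_prefix w u ->
  exists2 q, is_prefix w (q ++ u) & pvec R q = v.
Proof.
move=> phiP phi_w lim_w N_gt0 BN [q pref_q <-] pref_u.
have [n0 /(_ (n0 * N) (leq_pmulr _ N_gt0))] := lim_w (size u).
rewrite pref_u => /prefixP[r def_r]; exists (iter (n0 * N) phi q).
  have := iter_prefix_morphism (n0 * N) phi_w pref_q.
  by rewrite (iter_morphism (n0 * N) phiP).2 def_r catA => /is_prefix_catl.
by rewrite pvec_iter // mulnC exprM BN expr1n mulmx1.
Qed.

Lemma mulrn_Zp_row m s (v : 'rV['Z_m]_s) : 1 < m -> (v *+ m = 0)%R.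
Proof. by move=> m_gt1; rewrite -scaler_nat pchar_Zp ?scale0r. Qed.

(** Sums come from transporting one prefix in front of another, negatives are multiples by [m - 1],
    and the inverse of the matrix is its power [N - 1]. *)
Lemma occ_class_group m s (phi : seq 'I_s.+1 -> seq 'I_s.+1) w a t N :
    1 < m ->
    morphism_words phi -> phi [:: a] = a :: t ->
    (forall q, is_prefix w q -> is_prefix w (phi q)) ->
    word_limit (fun n => iter n phi [:: a]) w -> w 0 = a ->
    0 < N -> (incidence 'Z_m phi ^+ N = 1)%R ->
  let S := @occ_class 'Z_m s.+1 w a in
  [/\ S 0%R, forall u v, S u -> S v -> S (u + v)%R, forall v, S v -> S (- v)%R
    & forall v, S (v *m incidence 'Z_m phi)%R -> S v].
Proof.
move=> m_gt1 phiP phi_a phi_w lim_w w0 N_gt0 BN S.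
have S0 : S 0%R by exists [::]; rewrite ?pvec_nil // /is_prefix /= /mkseq /= w0.
have SD u v : S u -> S v -> S (u + v)%R.
  move=> Su [q pref_q <-].
  have [q' pref_q' <-] := occ_class_transport phiP phi_w lim_w N_gt0 BN Su pref_q.
  by exists (q' ++ q); rewrite -?catA // pvec_cat.
have SMn v n : S v -> S (v *+ n)%R.
  by move=> Sv; elim: n => [|n IHn]; rewrite ?mulr0n // mulrS; apply: SD.
have SB v n : S v -> S (v *m incidence 'Z_m phi ^+ n)%R.
  move=> Sv; elim: n => [|n [q pref_q def_q]]; first by rewrite expr0 mulmx1.
  exists (phi q); last by rewrite pvec_morphism // def_q exprSr mulmxA.
  apply: (@is_prefix_catl _ _ _ t).
  by rewrite -catA /= -phi_a -phiP.2; apply: phi_w.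
split=> // [v Sv | v SvB].
  have -> : (- v = v *+ m.-1)%R; last exact: SMn.
  by apply/eqP; rewrite eq_sym -addr_eq0 -mulrSr prednK ?mulrn_Zp_row // ltnW.
have := SB _ N.-1 SvB; rewrite -mulmxA (_ : (incidence _ _ *m _ = 1)%R) ?mulmx1 //.
by rewrite -BN -[in RHS](prednK N_gt0) exprS.
Qed.

Lemma pvec_letters m s (S : 'rV['Z_m]_s -> Prop) :
    S 0%R -> (forall u v, S u -> S v -> S (u + v)%R) ->
    (forall c, S (pvec _ [:: c])) ->
  forall v, S v.
Proof.
move=> S0 SD Sc v; rewrite (row_sum_delta v); apply: big_ind => // j _.
rewrite -[v _ _]natr_Zp scaler_nat -pvec1.
by elim: (nat_of_ord _) => [|n IHn]; rewrite ?mulr0n // mulrS; apply: SD.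
Qed.

(** * The binary case *)

Lemma det_morphism_matrix (phi : seq 'I_2 -> seq 'I_2) (a b : 'I_2) : a != b ->
  (\det (morphism_matrix phi) =
     (count_mem a (phi [:: a]) * count_mem b (phi [:: b]))%:Z -
     (count_mem a (phi [:: b]) * count_mem b (phi [:: a]))%:Z)%R.
Proof.
have lift0 : lift ord0 ord0 = ord_max :> 'I_2 by apply/val_inj.
have lift1 : lift ord_max ord0 = ord0 :> 'I_2 by apply/val_inj.
have letter (c : 'I_2) : c = ord0 \/ c = ord_max.
  by case: c => [[|[|//]] lt_c]; [left | right]; apply/val_inj.
have -> : (\det (morphism_matrix phi) =
     (count_mem ord0 (phi [:: ord0]) * count_mem ord_max (phi [:: ord_max]))%:Z -
     (count_mem ord0 (phi [:: ord_max]) * count_mem ord_max (phi [:: ord0]))%:Z)%R.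
  rewrite (expand_det_row _ ord0) !big_ord_recl big_ord0 addr0 lift0.
  rewrite /cofactor !det_mx11 !mxE lift0 lift1 /= !PoszM; ring.
by case: (letter a) (letter b) => -> [] -> //= _; rewrite mulnC [in X in (_ - X)%R]mulnC.
Qed.

Lemma count_prefix (T : eqType) (q r : seq T) p : prefix q r -> count p q <= count p r.
Proof. by case/prefixP=> v ->; rewrite count_cat leq_addr. Qed.

Lemma recurrent_letter s (w : nat -> 'I_s) c i N :
  recurrent w -> w i = c -> exists2 j, N <= j & w j = c.
Proof.
move=> w_rec w_i; have fc : factor w [:: c] by exists i; rewrite /occurs_at /= w_i.
by have [j le_j [w_j]] := w_rec _ fc N; exists j.
Qed.

(** If [phi [:: b]] had no [a], then [phi] would preserve the number of letters [a], and [w] would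
    contain [a] only at its start. *)
Lemma recurrent_generated_image (phi : seq 'I_2 -> seq 'I_2) w a b :
    morphism_words phi -> word_limit (fun n => iter n phi [:: a]) w ->
    w 0 = a -> recurrent w -> (forall c, c = a \/ c = b) ->
    count_mem a (phi [:: a]) = 1 -> a \in phi [:: b].
Proof.
move=> phiP lim_w w0 w_rec letters count_aa; apply/negPn/negP=> /count_memPn count_ab.
have [neq_ab | eq_ab] := boolP (a != b); last first.
  by move: count_ab; rewrite -(eqP (negPn eq_ab)) count_aa.
have count_phi u : count_mem a (phi u) = count_mem a u.
  elim: u => [|c u IHu]; first by rewrite phiP.1.
  rewrite -cat1s phiP.2 !count_cat IHu; congr (_ + _).
  by case: (letters c) => ->; rewrite ?count_aa ?count_ab /= ?eqxx // eq_sym (negPf neq_ab).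
have [[//|i] _ w_i] := recurrent_letter 1 w_rec w0.
have [N /(_ N (leqnn N))/(count_prefix (pred1 a))] := lim_w i.+2.
have -> : count_mem a (iter N phi [:: a]) = 1.
  by elim: N => [|N IHN]; rewrite /= ?eqxx // count_phi.
rewrite mkseqSr count_cat /= w_i eqxx addn0.
have : count_mem a (mkseq w 1) <= count_mem a (mkseq w i.+1).
  by apply: count_prefix; rewrite -(@take_mkseq_leq _ w 1 i.+1) ?prefix_take.
by rewrite /= w0 eqxx; lia.
Qed.

Lemma alternating_count (w : nat -> 'I_2) a b K :
    a != b -> (forall c, c = a \/ c = b) -> w 0 = a ->
    (forall i, i < K -> w i != w i.+1) ->
  forall i, i <= K -> count_mem a (mkseq w i) = count_mem b (mkseq w i) + (w i == b).
Proof.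
move=> neq_ab letters w0 w_alt; elim=> [_ | i IHi lt_i].
  by rewrite w0 /= (negPf neq_ab).
have := w_alt i lt_i; rewrite mkseqSr !count_cat /= IHi 1?ltnW //.
case: (letters (w i)) (letters (w i.+1)) => -> [] ->; rewrite ?eqxx ?(negPf neq_ab) //=.
all: by rewrite 1?[b == a]eq_sym ?(negPf neq_ab); lia.
Qed.

(** The images of [ab] and [abab] are alternating prefixes of [w]. If the first has [e] more letters
    [a] than [b], then [e] and [2 e] both lie in {0, 1}, so [e = 0]. The determinant is then a
    multiple of half the length of the image of [ab]. *)
Lemma alternating_det (phi : seq 'I_2 -> seq 'I_2) w a b t :
    morphism_words phi -> nonerasing phi -> phi [:: a] = a :: t -> t <> [::] ->
    (forall q, is_prefix w q -> is_prefix w (phi q)) ->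
    a != b -> (forall c, c = a \/ c = b) -> w 0 = a ->
    (forall i, i < size (phi (mkseq w 4)) + 4 -> w i != w i.+1) ->
  ~ (\det (morphism_matrix phi) = 1 \/ \det (morphism_matrix phi) = -1)%R.
Proof.
move=> phiP phi_ne phi_a t_ne phi_w neq_ab letters w0 w_alt.
have w_b i : w i = a -> i < size (phi (mkseq w 4)) + 4 -> w i.+1 = b.
  by move=> w_i /w_alt; rewrite w_i; case: (letters (w i.+1)) => -> //; rewrite eqxx.
have w_a i : w i = b -> i < size (phi (mkseq w 4)) + 4 -> w i.+1 = a.
  by move=> w_i /w_alt; rewrite w_i; case: (letters (w i.+1)) => -> //; rewrite eqxx.
have w1 : w 1 = b by apply: w_b w0 _; lia.
have w2 : w 2 = a by apply: w_a w1 _; lia.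
have w3 : w 3 = b by apply: w_b w2 _; lia.
have def_w2 : mkseq w 2 = [:: a] ++ [:: b] by rewrite /= /mkseq /= w0 w1.
have def_w4 : mkseq w 4 = mkseq w 2 ++ mkseq w 2 by rewrite /mkseq /= w0 w1 w2 w3.
have count_alt := alternating_count neq_ab letters w0 w_alt.
have size4 : size (phi (mkseq w 4)) = size (phi (mkseq w 2)) + size (phi (mkseq w 2)).
  by rewrite def_w4 phiP.2 size_cat.
have := count_alt (size (phi (mkseq w 4))) (leq_addr _ _).
have le2 : size (phi (mkseq w 2)) <= size (phi (mkseq w 4)) + 4 by rewrite size4 -addnA leq_addr.
have := count_alt _ le2.
rewrite !phi_w; try exact: is_prefix_mkseq.
rewrite def_w4 phiP.2 !count_cat def_w2 phiP.2 !count_cat => count2 count4.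
have size_count u : size u = count_mem a u + count_mem b u.
  rewrite -(count_predC (pred1 a)); congr (_ + _); apply: eq_count => c /=.
  by case: (letters c) => ->; rewrite ?eqxx ?(negPf neq_ab) // eq_sym neq_ab.
have := size_count (phi [:: a]); rewrite {1}phi_a => size_a.
have size_t : 0 < size t by case: (t) t_ne.
have size_b : 0 < size (phi [:: b]) by case: (phi _) (phi_ne b).
rewrite size_count in size_b; rewrite (det_morphism_matrix phi neq_ab).
move: size_a size_b count2 count4 => /=.
move: (count_mem a (phi [:: a])) (count_mem a (phi [:: b]))
  (count_mem b (phi [:: a])) (count_mem b (phi [:: b])) => aa ab ba bb.
move=> size_a size_b count2 count4.
have {count2 count4} eq_k : aa + ab = ba + bb by lia.
have -> : ((aa * bb)%:Z - (ab * ba)%:Z = (aa + ab)%:Z * (aa%:Z - ba%:Z))%R.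
  have -> : ((aa * bb)%:Z = aa%:Z * (aa%:Z + ab%:Z - ba%:Z))%R by nia.
  by rewrite PoszM PoszD; ring.
(* Both images together have length [2 * (aa + ab)], at least 3 since [t] is nonempty. *)
have k_ge2 : 2 <= aa + ab by lia.
move: (aa + ab) k_ge2 (aa%:Z - ba%:Z)%R => k k_ge2 z kz1.
have [z_ge1 | [z0 | z_le]] : (z >= 1 \/ z = 0 \/ z <= -1)%R by lia.
- by nia.
- by rewrite z0 mulr0 in kz1; lia.
- by nia.
Qed.

Lemma occ_class_full m (phi : seq 'I_2 -> seq 'I_2) w a b t :
    1 < m -> morphism_words phi -> nonerasing phi -> phi [:: a] = a :: t -> t <> [::] ->
    (forall q, is_prefix w q -> is_prefix w (phi q)) ->
    word_limit (fun n => iter n phi [:: a]) w -> w 0 = a -> recurrent w ->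
    a != b -> (forall c, c = a \/ c = b) -> (exists i, w i = b) ->
    (\det (morphism_matrix phi) = 1 \/ \det (morphism_matrix phi) = -1)%R ->
  (exists2 N, 0 < N & (incidence 'Z_m phi ^+ N = 1)%R) /\
  forall v, @occ_class 'Z_m _ w a v.
Proof.
move=> m_gt1 phiP phi_ne phi_a t_ne phi_w lim_w w0 w_rec neq_ab letters [ib w_ib] det1.
have [N N_gt0 BN] : exists2 N, 0 < N & (incidence 'Z_m phi ^+ N = 1)%R.
  apply: unit_expr_eq1; rewrite -[_ \is a _]/(_ \in unitmx) unitmxE det_incidence.
  by case: det1 => ->; rewrite ?rmorphN1 ?unitrN1 ?rmorph1 ?unitr1.
split; first by exists N.
set S := @occ_class _ _ _ _.
have [S0 SD SN SB] := occ_class_group m_gt1 phiP phi_a phi_w lim_w w0 N_gt0 BN.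
have Ssub u v : S u -> S (u + v)%R -> S v.
  by move=> Su Suv; rewrite -(addKr u v); apply: SD Suv; apply: SN.
pose V i := pvec 'Z_m (mkseq w i).
have VS i : V i.+1 = (V i + pvec 'Z_m [:: w i])%R by rewrite /V mkseqSr pvec_cat.
have SV i : w i = a -> S (V i).
  by move=> w_i; exists (mkseq w i); rewrite // -w_i -mkseqSr; apply: is_prefix_mkseq.
suff [Sa Sb] : S (pvec _ [:: a]) /\ S (pvec _ [:: b]).
  by apply: pvec_letters => // c; case: (letters c) => ->.
have a_in_b : a \in phi [:: b].
  apply/negPn/negP=> /[dup] /count_memPn count_ab; apply/negP/negPn.
  apply: (recurrent_generated_image phiP lim_w w0 w_rec letters).
  (* Without [a] in [phi [:: b]] the determinant is a product of two natural numbers, hence 1, and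
     [phi [:: a]] contains [a] once. *)
  move: det1; rewrite (det_morphism_matrix phi neq_ab) count_ab mul0n subr0.
  by case=> // -[/eqP]; rewrite muln_eq1 => /andP[/eqP].
(* With [phi [:: b] = t1 ++ a :: t2], each [b] preceded by a vector [V] puts [V A + t1] into [S].
   For adjacent letters [b] these differ by the image of the basis vector, and [S] is stable under
   the inverse. *)
have Sb_repeat i : w i = b -> w i.+1 = b -> S (pvec _ [:: b]).
  case/splitPr def_b: _ / a_in_b => [t1 t2].
  have lift_b j : w j = b -> S (V j *m incidence 'Z_m phi + pvec _ t1)%R.
    move=> w_j; exists (phi (mkseq w j) ++ t1); last by rewrite pvec_cat pvec_morphism.
    apply: (@is_prefix_catl _ _ _ t2).
    rewrite -!catA /= -def_b -phiP.2 -w_j -mkseqSr.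
    exact/phi_w/is_prefix_mkseq.
  move=> w_i w_i1; apply: SB; apply: (Ssub _ _ (lift_b _ w_i)).
  by have := lift_b _ w_i1; rewrite VS w_i mulmxDl addrAC.
(* Up to the first return of [a], [w] reads [a b^i a], so [a + i b] lies in [S]. *)
have Sa_return : S (pvec _ [:: b]) -> S (pvec _ [:: a]).
  move=> Sb; have SbMn n : S (pvec _ [:: b] *+ n)%R.
    by elim: n => [|n IHn]; rewrite ?mulr0n // mulrS; apply: SD.
  have ex_i : exists i, (0 < i) && (w i == a).
    by have [i i_gt0 w_i] := recurrent_letter 1 w_rec w0; exists i; rewrite i_gt0 w_i /=.
  case: (ex_minnP ex_i) => -[//|i] /andP[_ /eqP w_i] min_i.
  have {ex_i min_i} V_i k : k <= i -> V k.+1 = (pvec _ [:: b] *+ k + pvec _ [:: a])%R.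
    elim: k => [_ | k IHk lt_k]; first by rewrite VS w0 /V pvec_nil mulr0n.
    have w_k : w k.+1 = b.
      case: (letters (w k.+1)) => // w_k.
      by have := min_i k.+1; rewrite w_k eqxx /= ltnNge lt_k => /(_ isT).
    by rewrite VS (IHk (ltnW lt_k)) w_k addrAC -mulrSr.
  by apply: (Ssub _ _ (SbMn i)); rewrite -V_i //; apply: SV.
have [/hasP[i _ /eqP w_i] | /hasPn w_alt] :=
  boolP (has (fun i => w i == w i.+1) (iota 0 (size (phi (mkseq w 4)) + 4))); last first.
  have [] := alternating_det phiP phi_ne phi_a t_ne phi_w neq_ab letters w0 _ det1.
  by move=> i lt_i; apply: w_alt; rewrite mem_iota.
case: (letters (w i)) => w_i1; rewrite w_i1 in w_i; last first.
  by have Sb := Sb_repeat i w_i1 (esym w_i); split=> //; apply: Sa_return.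
have Sa : S (pvec _ [:: a]).
  by apply: (Ssub _ _ (SV i w_i1)); rewrite -w_i1 -VS; apply: SV.
(* This [b] stands at position [j + 1]. A neighbouring [b] gives the factor [bb]; otherwise [aba]
   puts [a + b] into [S]. *)
split=> //; case: ib w_ib => [|j] w_j; first by rewrite -w_j w0.
case: (letters (w j)) => w_j'; last exact: Sb_repeat w_j' w_j.
case: (letters (w j.+2)) => w_j2; last exact: Sb_repeat w_j w_j2.
apply: (Ssub _ _ Sa); apply: (Ssub _ _ (SV j w_j')).
by rewrite addrA -[in pvec _ [:: a]]w_j' -VS -w_j -VS; apply: SV.
Qed.

(** * The equivalence *)

Theorem theorem1 (phi : seq 'I_2 -> seq 'I_2) (w : nat -> 'I_2)
  (phi_morph : morphism_words phi) (phi_nonerasing : nonerasing phi)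
  (w_gen : generated_by phi w)
  (w_rec : recurrent w)
  (w_binary : forall c : 'I_2, exists i : nat, w i = c) :
  welldoc w <->
  ((\det (morphism_matrix phi))%R = 1%R \/ (\det (morphism_matrix phi))%R = (-1)%R).
Proof.
have [a [t [phi_a t_ne lim_w]]] := w_gen.
have phi_w q : is_prefix w q -> is_prefix w (phi q).
  exact: generated_prefix_morphism phi_morph phi_a lim_w.
split=> [|det1]; first exact: welldoc_det.
have w0 : w 0 = a by have [] := generated_iter_prefix 0 phi_morph phi_a lim_w.
have [b neq_ab letters] : exists2 b, a != b & forall c, c = a \/ c = b.
  exists (if a == ord0 then ord_max else ord0).
    by case: a {phi_a lim_w w0} => [[|[|//]] lt_a].
  case: a {phi_a lim_w w0} => [[|[|//]] lt_a] [[|[|//]] lt_c];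
    by [left; apply/val_inj | right; apply/val_inj].
apply/welldocP=> m u V m_gt0 [i occ_i].
have pref_u := (occurs_at_prefix w u i).1 occ_i.
(* Modulo 1 any occurrence of [u] will do; ['Z_m] represents the residues modulo [m] only for
   [m > 1]. *)
have [m_gt1 | m_le1] := ltnP 1 m; last first.
  exists (mkseq w i) => // j.
  by rewrite (_ : m = 1) ?modn1 //; apply/eqP; rewrite eqn_leq m_le1.
have [[N N_gt0 BN] full] := occ_class_full m_gt1 phi_morph phi_nonerasing phi_a t_ne
  phi_w lim_w w0 w_rec neq_ab letters (w_binary b) det1.
(* The word transported is [mkseq w i ++ u], so the vector of [mkseq w i] is subtracted in
   advance. *)
pose v : 'rV['Z_m]_2 := (\row_j (V j)%:R - pvec _ (mkseq w i))%R.
have [q pref_q def_v] :=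
  occ_class_transport phi_morph phi_w lim_w N_gt0 BN (full v) pref_u.
exists (q ++ mkseq w i); first by rewrite -catA.
have /rowP eqV : pvec 'Z_m (q ++ mkseq w i) = (\row_j (V j)%:R)%R.
  by rewrite pvec_cat def_v subrK.
move=> j; have /(congr1 (@nat_of_ord _)) := eqV j; rewrite !mxE.
by rewrite !val_Zp_nat.
Qed.
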